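(* (I) For $s\le 2$ there are no coefficients of an explicit $s$-stage stochastic Runge--Kutta method satisfying all of the conditions 1.--50. (II) Let $s=3$, and consider coefficients $\alpha,\beta^{(1)},\dots,\beta^{(4)}\in\mathbb{R}^3$, $A^{(q)},B^{(q)}\in\mathbb{R}^{3\times3}$ ($q=0,1,2$, strictly lower triangular), with the convention that $A^{(0)}_{31}=A^{(0)}_{32}=B^{(0)}_{31}=B^{(0)}_{32}=0$ whenever $\alpha_3=0$ (these entries are then irrelevant for the scheme). The coefficients satisfying all of the conditions 1.--50. are completely characterized as follows: there are $c_1\in\{-1,1\}$ and $c_2,c_3,c_4,c_5\in\mathbb{R}$ with $c_3\ne0$, $c_4\neq0$ such that $$\beta^{(1)T}=\begin{bmatrix}c_1-\tfrac{c_1}{2c_3^2}&\tfrac{c_1}{4c_3^2}&\tfrac{c_1}{4c_3^2}\end{bmatrix},\quad \beta^{(2)T}=\begin{bmatrix}0&\tfrac1{2c_3}&-\tfrac1{2c_3}\end{bmatrix},$$ $$\beta^{(3)T}=\begin{bmatrix}-\tfrac{c_1}{2c_4^2}&\tfrac{c_1}{4c_4^2}&\tfrac{c_1}{4c_4^2}\end{bmatrix},\quad \beta^{(4)T}=\begin{bmatrix}0&\tfrac1{2c_4}&-\tfrac1{2c_4}\end{bmatrix},$$ $$A^{(1)}=\begin{bmatrix}0&0&0\\c_3^2&0&0\\c_3^2-c_2&c_2&0\end{bmatrix},\quad B^{(1)}=\begin{bmatrix}0&0&0\\c_3&0&0\\-c_3&0&0\end{bmatrix},\quad A^{(2)}=\begin{bmatrix}0&0&0\\0&0&0\\c_5&-c_5&0\end{bmatrix},\quad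 B^{(2)}=\begin{bmatrix}0&0&0\\c_4&0&0\\-c_4&0&0\end{bmatrix},$$ and one of the following cases holds: (A) $c_2=c_5=0$ and $$\alpha^T=\begin{bmatrix}\tfrac12&\tfrac12&0\end{bmatrix},\quad A^{(0)}=\begin{bmatrix}0&0&0\\1&0&0\\0&0&0\end{bmatrix},\quad B^{(0)}=\begin{bmatrix}0&0&0\\c_1&0&0\\0&0&0\end{bmatrix}.$$ (B.a.i) For some $c_6,c_7\in\mathbb{R}$: $$\alpha^T=\begin{bmatrix}\tfrac12-c_6&c_6&\tfrac12\end{bmatrix},\quad A^{(0)}=\begin{bmatrix}0&0&0\\0&0&0\\c_7&1-c_7&0\end{bmatrix},\quad B^{(0)}=\begin{bmatrix}0&0&0\\0&0&0\\c_1&0&0\end{bmatrix}.$$ (B.a.ii) For some $c_6,c_7,c_8\in\mathbb{R}$ with $c_6\ne0$: $$\alpha^T=\begin{bmatrix}\tfrac12-\tfrac{1-c_7-c_8}{2c_6}&\tfrac{1-c_7-c_8}{2c_6}&\tfrac12\end{bmatrix},\quad A^{(0)}=\begin{bmatrix}0&0&0\\c_6&0&0\\c_7&c_8&0\end{bmatrix},\quad B^{(0)}=\begin{bmatrix}0&0&0\\0&0&0\\c_1&0&0\end{bmatrix}.$$ (B.b.i) $c_2=c_5=0$ and, for some $c_6,c_7,c_8,c_9\in\mathbb{R}$ with $c_6\ne0$, $c_7\neq0$, $c_6\ne-c_7$, with $\kappa:=c_6c_7(2c_6+2c_7-1)\ge0$ and $c_6\neq\pm\sqrt{\kappa}$ (i.e.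 $c_6\ne\sqrt\kappa$ and $c_6\ne-\sqrt\kappa$), and with $\lambda:=\frac{1-2c_6c_8}{2c_7}$: $$\alpha^T=\begin{bmatrix}1-c_6-c_7&c_6&c_7\end{bmatrix},\quad A^{(0)}=\begin{bmatrix}0&0&0\\c_8&0&0\\\lambda-c_9&c_9&0\end{bmatrix},\quad B^{(0)}=\begin{bmatrix}0&0&0\\\frac{c_1}{2}\frac{c_6\mp\sqrt\kappa}{c_6(c_6+c_7)}&0&0\\\frac{c_1}{2}\frac{c_7\pm\sqrt\kappa}{c_7(c_6+c_7)}&0&0\end{bmatrix}$$ (upper signs in both entries of $B^{(0)}$ or lower signs in both). (B.b.ii) $c_2=c_5=0$ and, for some $c_6,c_7,c_8\in\mathbb{R}$ with $c_8\neq0$: $$\alpha^T=\begin{bmatrix}\tfrac12&0&\tfrac12\end{bmatrix},\quad A^{(0)}=\begin{bmatrix}0&0&0\\c_6&0&0\\1-c_7&c_7&0\end{bmatrix},\quad B^{(0)}=\begin{bmatrix}0&0&0\\c_8&0&0\\c_1&0&0\end{bmatrix}.$$ (B.b.iii) $c_2=c_5=0$ and, for some $c_6,c_7,c_8\in\mathbb{R}$ with $c_6\notin\{-\tfrac12,0\}$: $$\alpha^T=\begin{bmatrix}1&c_6&-c_6\end{bmatrix},\quad A^{(0)}=\begin{bmatrix}0&0&0\\c_7&0&0\\\frac{1-2c_6c_7}{-2c_6}-c_8&c_8&0\end{bmatrix},\quad B^{(0)}=\begin{bmatrix}0&0&0\\\frac{c_1}{2}\left(1+\frac1{2c_6}\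right)&0&0\\\frac{c_1}{2}\left(1-\frac1{2c_6}\right)&0&0\end{bmatrix}.$$
   Context: An explicit $s$-stage stochastic Runge--Kutta (SRK) method of the class considered is determined by vectors $\alpha,\beta^{(1)},\beta^{(2)},\beta^{(3)},\beta^{(4)}\in\mathbb{R}^s$ and matrices $A^{(q)},B^{(q)}\in\mathbb{R}^{s\times s}$, $q=0,1,2$, with $A^{(q)}_{ij}=B^{(q)}_{ij}=0$ for $j\ge i$. Let $e=(1,\dots,1)^T\in\mathbb{R}^s$. Products and powers of column vectors are taken component-wise. ''Order (2,2)'' (deterministic order 2 and weak stochastic order 2) is understood through the order conditions 1.--50.: 1. $\alpha^Te=1$; 2. $\beta^{(4)T}e=0$; 3. $\beta^{(3)T}e=0$; 4. $(\beta^{(1)T}e)^2=1$; 5. $\beta^{(2)T}e=0$; 6. $\beta^{(1)T}B^{(1)}e=0$; 7. $\beta^{(3)T}B^{(2)}e=0$; 8. $\alpha^TA^{(0)}e=\tfrac12$; 9. $\alpha^T(B^{(0)}e)^2=\tfrac12$; 10. $(\beta^{(1)T}e)(\alpha^TB^{(0)}e)=\tfrac12$; 11. $(\beta^{(1)T}e)(\beta^{(1)T}A^{(1)}e)=\tfrac12$; 12. $\beta^{(3)T}A^{(2)}e=0$; 13. $\beta^{(2)T}B^{(1)}e=1$; 14. $\beta^{(4)T}B^{(2)}e=1$; 15. $(\beta^{(1)T}e)(\beta^{(1)T}(B^{(1)}e)^2)=\tfrac12$; 16. $(\beta^{(1)T}e)(\beta^{(3)T}(B^{(2)}e)^2)=\tfrac12$;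 17. $\beta^{(1)T}(B^{(1)}(B^{(1)}e))=0$; 18. $\beta^{(3)T}(B^{(2)}(B^{(1)}e))=0$; 19. $\beta^{(3)T}(A^{(2)}(B^{(0)}e))=0$; 20. $\beta^{(1)T}(A^{(1)}(B^{(0)}e))=0$; 21. $\alpha^T(B^{(0)}(B^{(1)}e))=0$; 22. $\beta^{(2)T}A^{(1)}e=0$; 23. $\beta^{(4)T}A^{(2)}e=0$; 24. $\beta^{(1)T}((A^{(1)}e)(B^{(1)}e))=0$; 25. $\beta^{(3)T}((A^{(2)}e)(B^{(2)}e))=0$; 26. $\beta^{(4)T}(A^{(2)}(B^{(0)}e))=0$; 27. $\beta^{(2)T}(A^{(1)}(B^{(0)}e))=0$; 28. $\beta^{(2)T}(A^{(1)}(B^{(0)}e)^2)=0$; 29. $\beta^{(4)T}(A^{(2)}(B^{(0)}e)^2)=0$; 30. $\beta^{(3)T}(B^{(2)}(A^{(1)}e))=0$; 31. $\beta^{(1)T}(B^{(1)}(A^{(1)}e))=0$; 32. $\beta^{(2)T}(B^{(1)}e)^2=0$; 33. $\beta^{(4)T}(B^{(2)}e)^2=0$; 34. $\beta^{(4)T}(B^{(2)}(B^{(1)}e))=0$; 35. $\beta^{(2)T}(B^{(1)}(B^{(1)}e))=0$; 36. $\beta^{(1)T}(B^{(1)}e)^3=0$; 37. $\beta^{(3)T}(B^{(2)}e)^3=0$; 38. $\beta^{(1)T}(B^{(1)}(B^{(1)}e)^2)=0$; 39. $\beta^{(3)T}(B^{(2)}(B^{(1)}e)^2)=0$; 40. $\alpha^T((B^{(0)}e)(B^{(0)}(B^{(1)}e)))=0$;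 41. $\beta^{(1)T}((A^{(1)}(B^{(0)}e))(B^{(1)}e))=0$; 42. $\beta^{(3)T}((A^{(2)}(B^{(0)}e))(B^{(2)}e))=0$; 43. $\beta^{(1)T}(A^{(1)}(B^{(0)}(B^{(1)}e)))=0$; 44. $\beta^{(3)T}(A^{(2)}(B^{(0)}(B^{(1)}e)))=0$; 45. $\beta^{(1)T}(B^{(1)}(A^{(1)}(B^{(0)}e)))=0$; 46. $\beta^{(3)T}(B^{(2)}(A^{(1)}(B^{(0)}e)))=0$; 47. $\beta^{(1)T}((B^{(1)}e)(B^{(1)}(B^{(1)}e)))=0$; 48. $\beta^{(3)T}((B^{(2)}e)(B^{(2)}(B^{(1)}e)))=0$; 49. $\beta^{(1)T}(B^{(1)}(B^{(1)}(B^{(1)}e)))=0$; 50. $\beta^{(3)T}(B^{(2)}(B^{(1)}(B^{(1)}e)))=0$.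
   Formalization: In case (B.b.i) the condition excluding both c_6=√κ and c_6=-√κ is replaced by c_6≠√κ for the upper signs and c_6≠-√κ for the lower signs; as stated, the list omits valid schemes, e.g. c_1=1, α^T=[-1/2,1,1/2], B^(0)_21=2/3, B^(0)_31=-1/3. *)

(* Defs.v *)
(* MathComp; the real numbers are an arbitrary realType *)
From mathcomp Require Import all_boot all_order all_algebra reals.

Set Implicit Arguments.
Unset Strict Implicit.
Unset Printing Implicit Defensive.

Import Order.TTheory GRing.Theory Num.Theory.

Local Open Scope ring_scope.

Record srk_coeffs (R : realType) (s : nat) := SRKCoeffs {
  alpha : 'cV[R]_s;
  beta1 : 'cV[R]_s;
  beta2 : 'cV[R]_s;
  beta3 : 'cV[R]_s;
  beta4 : 'cV[R]_s;
  A0 : 'M[R]_s;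
  A1 : 'M[R]_s;
  A2 : 'M[R]_s;
  B0 : 'M[R]_s;
  B1 : 'M[R]_s;
  B2 : 'M[R]_s
}.

Definition strictly_lower (R : realType) (s : nat) (A : 'M[R]_s) : Prop :=
  forall i j : 'I_s, (i <= j)%N -> A i j = 0.

Definition explicit_srk (R : realType) (s : nat) (M : srk_coeffs R s) : Prop :=
  [/\ strictly_lower (A0 M), strictly_lower (A1 M) & strictly_lower (A2 M)] /\
  [/\ strictly_lower (B0 M), strictly_lower (B1 M) & strictly_lower (B2 M)].

Definition ones (R : realType) (s : nat) : 'cV[R]_s := const_mx 1.

Definition dot (R : realType) (s : nat) (u v : 'cV[R]_s) : R :=
  (u^T *m v) 0 0.

Definition cmul (R : realType) (s : nat) (u v : 'cV[R]_s) : 'cV[R]_s :=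
  map2_mx *%R u v.

Definition cpow (R : realType) (s : nat) (u : 'cV[R]_s) (k : nat) : 'cV[R]_s :=
  map_mx (fun x => x ^+ k) u.

Record order22 (R : realType) (s : nat) (M : srk_coeffs R s) : Prop := Order22 {
  cond1 : dot (alpha M) (ones R s) = 1;
  cond2 : dot (beta4 M) (ones R s) = 0;
  cond3 : dot (beta3 M) (ones R s) = 0;
  cond4 : dot (beta1 M) (ones R s) ^+ 2 = 1;
  cond5 : dot (beta2 M) (ones R s) = 0;
  cond6 : dot (beta1 M) (B1 M *m ones R s) = 0;
  cond7 : dot (beta3 M) (B2 M *m ones R s) = 0;
  cond8 : dot (alpha M) (A0 M *m ones R s) = 1 / 2;
  cond9 : dot (alpha M) (cpow (B0 M *m ones R s) 2) = 1 / 2;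
  cond10 : dot (beta1 M) (ones R s) * dot (alpha M) (B0 M *m ones R s) = 1 / 2;
  cond11 : dot (beta1 M) (ones R s) * dot (beta1 M) (A1 M *m ones R s) = 1 / 2;
  cond12 : dot (beta3 M) (A2 M *m ones R s) = 0;
  cond13 : dot (beta2 M) (B1 M *m ones R s) = 1;
  cond14 : dot (beta4 M) (B2 M *m ones R s) = 1;
  cond15 : dot (beta1 M) (ones R s)
           * dot (beta1 M) (cpow (B1 M *m ones R s) 2) = 1 / 2;
  cond16 : dot (beta1 M) (ones R s)
           * dot (beta3 M) (cpow (B2 M *m ones R s) 2) = 1 / 2;
  cond17 : dot (beta1 M) (B1 M *m (B1 M *m ones R s)) = 0;
  cond18 : dot (beta3 M) (B2 M *m (B1 M *m ones R s)) = 0;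
  cond19 : dot (beta3 M) (A2 M *m (B0 M *m ones R s)) = 0;
  cond20 : dot (beta1 M) (A1 M *m (B0 M *m ones R s)) = 0;
  cond21 : dot (alpha M) (B0 M *m (B1 M *m ones R s)) = 0;
  cond22 : dot (beta2 M) (A1 M *m ones R s) = 0;
  cond23 : dot (beta4 M) (A2 M *m ones R s) = 0;
  cond24 : dot (beta1 M) (cmul (A1 M *m ones R s) (B1 M *m ones R s)) = 0;
  cond25 : dot (beta3 M) (cmul (A2 M *m ones R s) (B2 M *m ones R s)) = 0;
  cond26 : dot (beta4 M) (A2 M *m (B0 M *m ones R s)) = 0;
  cond27 : dot (beta2 M) (A1 M *m (B0 M *m ones R s)) = 0;
  cond28 : dot (beta2 M) (A1 M *m cpow (B0 M *m ones R s) 2) = 0;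
  cond29 : dot (beta4 M) (A2 M *m cpow (B0 M *m ones R s) 2) = 0;
  cond30 : dot (beta3 M) (B2 M *m (A1 M *m ones R s)) = 0;
  cond31 : dot (beta1 M) (B1 M *m (A1 M *m ones R s)) = 0;
  cond32 : dot (beta2 M) (cpow (B1 M *m ones R s) 2) = 0;
  cond33 : dot (beta4 M) (cpow (B2 M *m ones R s) 2) = 0;
  cond34 : dot (beta4 M) (B2 M *m (B1 M *m ones R s)) = 0;
  cond35 : dot (beta2 M) (B1 M *m (B1 M *m ones R s)) = 0;
  cond36 : dot (beta1 M) (cpow (B1 M *m ones R s) 3) = 0;
  cond37 : dot (beta3 M) (cpow (B2 M *m ones R s) 3) = 0;
  cond38 : dot (beta1 M) (B1 M *m cpow (B1 M *m ones R s) 2) = 0;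
  cond39 : dot (beta3 M) (B2 M *m cpow (B1 M *m ones R s) 2) = 0;
  cond40 : dot (alpha M)
             (cmul (B0 M *m ones R s) (B0 M *m (B1 M *m ones R s))) = 0;
  cond41 : dot (beta1 M)
             (cmul (A1 M *m (B0 M *m ones R s)) (B1 M *m ones R s)) = 0;
  cond42 : dot (beta3 M)
             (cmul (A2 M *m (B0 M *m ones R s)) (B2 M *m ones R s)) = 0;
  cond43 : dot (beta1 M) (A1 M *m (B0 M *m (B1 M *m ones R s))) = 0;
  cond44 : dot (beta3 M) (A2 M *m (B0 M *m (B1 M *m ones R s))) = 0;
  cond45 : dot (beta1 M) (B1 M *m (A1 M *m (B0 M *m ones R s))) = 0;
  cond46 : dot (beta3 M) (B2 M *m (A1 M *m (B0 M *m ones R s))) = 0;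
  cond47 : dot (beta1 M)
             (cmul (B1 M *m ones R s) (B1 M *m (B1 M *m ones R s))) = 0;
  cond48 : dot (beta3 M)
             (cmul (B2 M *m ones R s) (B2 M *m (B1 M *m ones R s))) = 0;
  cond49 : dot (beta1 M) (B1 M *m (B1 M *m (B1 M *m ones R s))) = 0;
  cond50 : dot (beta3 M) (B2 M *m (B1 M *m (B1 M *m ones R s))) = 0
}.

(* Third row and column have ordinal index 2 in 'I_3. *)
Definition alpha3_convention (R : realType) (M : srk_coeffs R 3) : Prop :=
  alpha M 2 0 = 0 ->
  [/\ A0 M 2 0 = 0, A0 M 2 1 = 0, B0 M 2 0 = 0 & B0 M 2 1 = 0].

Definition rv3 (R : realType) (x1 x2 x3 : R) : 'rV[R]_3 :=
  \row_(j < 3) [:: x1; x2; x3]`_j.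

Definition mx3 (R : realType) (r1 r2 r3 : seq R) : 'M[R]_3 :=
  \matrix_(i < 3, j < 3) (nth [::] [:: r1; r2; r3] i)`_j.

Definition common_form (R : realType) (M : srk_coeffs R 3)
    (c1 c2 c3 c4 c5 : R) : Prop :=
  [/\ (beta1 M)^T = rv3 (c1 - c1 / (2 * c3 ^+ 2))
                        (c1 / (4 * c3 ^+ 2)) (c1 / (4 * c3 ^+ 2)),
      (beta2 M)^T = rv3 0 (1 / (2 * c3)) (- (1 / (2 * c3))),
      (beta3 M)^T = rv3 (- (c1 / (2 * c4 ^+ 2)))
                        (c1 / (4 * c4 ^+ 2)) (c1 / (4 * c4 ^+ 2)) &
      (beta4 M)^T = rv3 0 (1 / (2 * c4)) (- (1 / (2 * c4)))] /\
  [/\ A1 M = mx3 [:: 0;            0;    0]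
                 [:: c3 ^+ 2;      0;    0]
                 [:: c3 ^+ 2 - c2; c2;   0],
      B1 M = mx3 [:: 0;            0;    0]
                 [:: c3;           0;    0]
                 [:: - c3;         0;    0],
      A2 M = mx3 [:: 0;            0;    0]
                 [:: 0;            0;    0]
                 [:: c5;           - c5; 0] &
      B2 M = mx3 [:: 0;            0;    0]
                 [:: c4;           0;    0]
                 [:: - c4;         0;    0]].

Definition caseA (R : realType) (M : srk_coeffs R 3) (c1 c2 c5 : R) : Prop :=
  (c2 = 0 /\ c5 = 0) /\
  [/\ (alpha M)^T = rv3 (1 / 2) (1 / 2) 0,
      A0 M = mx3 [:: 0;  0; 0]
                 [:: 1;  0; 0]
                 [:: 0;  0; 0] &
      B0 M = mx3 [:: 0;  0; 0]
                 [:: c1; 0; 0]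
                 [:: 0;  0; 0]].

Definition caseBai (R : realType) (M : srk_coeffs R 3) (c1 : R) : Prop :=
  exists c6 c7 : R,
  [/\ (alpha M)^T = rv3 (1 / 2 - c6) c6 (1 / 2),
      A0 M = mx3 [:: 0;  0;      0]
                 [:: 0;  0;      0]
                 [:: c7; 1 - c7; 0] &
      B0 M = mx3 [:: 0;  0;      0]
                 [:: 0;  0;      0]
                 [:: c1; 0;      0]].

Definition caseBaii (R : realType) (M : srk_coeffs R 3) (c1 : R) : Prop :=
  exists c6 c7 c8 : R, c6 != 0 /\
  [/\ (alpha M)^T = rv3 (1 / 2 - (1 - c7 - c8) / (2 * c6))
                        ((1 - c7 - c8) / (2 * c6)) (1 / 2),
      A0 M = mx3 [:: 0;  0;  0]
                 [:: c6; 0;  0]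
                 [:: c7; c8; 0] &
      B0 M = mx3 [:: 0;  0;  0]
                 [:: 0;  0;  0]
                 [:: c1; 0;  0]].

(* sg = 1 selects the upper and sg = -1 the lower sign in all three of
     c6 != +- sqrt kappa,  c6 -+ sqrt kappa,  c7 +- sqrt kappa.
   So the condition on c6 says that B0_21 != 0 for the selected root.
   Excluding both c6 = sqrt kappa and c6 = - sqrt kappa for either selection
   would lose admissible schemes: c6^2 = kappa forces c7 = 1/2, and then for
   c6 = 1 (kappa = 1) the lower sign gives alpha^T = [-1/2, 1, 1/2],
   B0_21 = 2 c1 / 3, B0_31 = - c1 / 3, which satisfies all order conditions
   and belongs to no other case. *)
Definition caseBbi (R : realType) (M : srk_coeffs R 3) (c1 c2 c5 : R) : Prop :=
  (c2 = 0 /\ c5 = 0) /\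
  exists c6 c7 c8 c9 sg : R,
  let kappa := c6 * c7 * (2 * c6 + 2 * c7 - 1) in
  let lambda := (1 - 2 * c6 * c8) / (2 * c7) in
  [/\ c6 != 0, c7 != 0 & c6 != - c7] /\
  [/\ 0 <= kappa, sg = 1 \/ sg = -1 & c6 != sg * Num.sqrt kappa] /\
  [/\ (alpha M)^T = rv3 (1 - c6 - c7) c6 c7,
      A0 M = mx3 [:: 0;           0;  0]
                 [:: c8;          0;  0]
                 [:: lambda - c9; c9; 0] &
      B0 M = mx3
        [:: 0; 0; 0]
        [:: c1 / 2 * ((c6 - sg * Num.sqrt kappa) / (c6 * (c6 + c7))); 0; 0]
        [:: c1 / 2 * ((c7 + sg * Num.sqrt kappa) / (c7 * (c6 + c7))); 0; 0]].

Definition caseBbii (R : realType) (M : srk_coeffs R 3) (c1 c2 c5 : R) : Prop :=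
  (c2 = 0 /\ c5 = 0) /\
  exists c6 c7 c8 : R, c8 != 0 /\
  [/\ (alpha M)^T = rv3 (1 / 2) 0 (1 / 2),
      A0 M = mx3 [:: 0;      0;  0]
                 [:: c6;     0;  0]
                 [:: 1 - c7; c7; 0] &
      B0 M = mx3 [:: 0;      0;  0]
                 [:: c8;     0;  0]
                 [:: c1;     0;  0]].

Definition caseBbiii (R : realType) (M : srk_coeffs R 3) (c1 c2 c5 : R) : Prop :=
  (c2 = 0 /\ c5 = 0) /\
  exists c6 c7 c8 : R, (c6 != - (1 / 2) /\ c6 != 0) /\
  [/\ (alpha M)^T = rv3 1 c6 (- c6),
      A0 M = mx3 [:: 0;                                           0;  0]
                 [:: c7;                                          0;  0]
                 [:: (1 - 2 * c6 * c7) / (- (2 * c6)) - c8;       c8; 0] &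
      B0 M = mx3 [:: 0;                                           0;  0]
                 [:: c1 / 2 * (1 + 1 / (2 * c6));                 0;  0]
                 [:: c1 / 2 * (1 - 1 / (2 * c6));                 0;  0]].

(* Main.v *)
(* Conditions 6, 15 and 36 are the moments p u + q v = 0,
   p u^2 + q v^2 = c1 / 2, p u^3 + q v^3 = 0 of beta1 at the last two entries
   u, v of B1 e (the first one is 0): they force v = - u and p = q, which
   determines beta1 and then beta2 up to c3 = u.  Conditions 7, 16, 37 do the
   same for beta3, beta4, B2, with c4.  The remaining conditions leave one free
   entry c2 of A1, one free entry c5 of A2, alpha3 B0_32 = 0, c2 = c5 = 0 unless
   B0_21 = 0, and equations for alpha, A0, B0.  The cases are then separated by
   the vanishing of B0_21, alpha3, alpha2 and alpha2 + alpha3; if none of these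
   vanishes, B0_21 is a root of a quadratic equation of discriminant kappa. *)
Require Import Defs.
From mathcomp Require Import all_boot all_order all_algebra reals.
From mathcomp Require Import ring lra.

Import Order.TTheory GRing.Theory Num.Theory.

Local Open Scope ring_scope.

(** * Entries of vectors and strictly lower triangular matrices with three stages *)

Lemma sum_ord3 {R : realType} (F : 'I_3 -> R) :
  \sum_(i < 3) F i = F 0 + F 1 + F 2.
Proof.
rewrite !big_ord_recl big_ord0 addr0 addrA.
by congr (F _ + F _ + F _); apply/val_inj.
Qed.

Lemma dot3E {R : realType} (u v : 'cV[R]_3) :
  dot u v = u 0 0 * v 0 0 + u 1 0 * v 1 0 + u 2 0 * v 2 0.
Proof. by rewrite /dot mxE sum_ord3 !mxE. Qed.

(** Stated as a product type so that the three equations serve together as a single rewriting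
    multi-rule. *)
Lemma lower_mulmxE {R : realType} {A : 'M[R]_3} (lowA : strictly_lower A)
    (v : 'cV[R]_3) :
  (((A *m v) 0 0 = 0)%R * ((A *m v) 1 0 = A 1 0 * v 0 0)%R
  * ((A *m v) 2 0 = A 2 0 * v 0 0 + A 2 1 * v 1 0)%R)%type.
Proof.
split; first split; rewrite mxE sum_ord3.
- by rewrite (lowA 0 0) // (lowA 0 1) // (lowA 0 2) // !mul0r !addr0.
- by rewrite (lowA 1 1) // (lowA 1 2) // !mul0r !addr0.
- by rewrite (lowA 2 2) // mul0r addr0.
Qed.

Lemma lower_eq_mx3 {R : realType} {A : 'M[R]_3} (a b c : R) :
  strictly_lower A ->
  A = mx3 [:: 0; 0; 0] [:: a; 0; 0] [:: b; c; 0] <->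
  [/\ A 1 0 = a, A 2 0 = b & A 2 1 = c].
Proof.
move=> lowA; split=> [-> | [A10 A20 A21]]; first by rewrite !mxE.
apply/matrixP=> i j; rewrite !mxE.
case: i => -[|[|[|//]]] ltim; case: j => -[|[|[|//]]] ltjn /=;
  try exact: lowA.
- by rewrite -A10; congr (A _ _); apply/val_inj.
- by rewrite -A20; congr (A _ _); apply/val_inj.
- by rewrite -A21; congr (A _ _); apply/val_inj.
Qed.

Lemma tr_eq_rv3 {R : realType} (v : 'cV[R]_3) (x y z : R) :
  v^T = rv3 x y z <-> [/\ v 0 0 = x, v 1 0 = y & v 2 0 = z].
Proof.
split=> [/matrixP vE | [v0 v1 v2]].
  by split; [have := vE 0 0 | have := vE 0 1 | have := vE 0 2]; rewrite !mxE.
apply/matrixP=> i j; rewrite !mxE ord1.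
case: j => -[|[|[|//]]] ltjn /=.
- by rewrite -v0; congr (v _ _); apply/val_inj.
- by rewrite -v1; congr (v _ _); apply/val_inj.
- by rewrite -v2; congr (v _ _); apply/val_inj.
Qed.

Lemma onesE {R : realType} {s : nat} (i : 'I_s) : ones R s i 0 = 1.
Proof. by rewrite mxE. Qed.

Lemma cpowE {R : realType} {s : nat} (u : 'cV[R]_s) k i :
  cpow u k i 0 = u i 0 ^+ k.
Proof. by rewrite mxE. Qed.

Lemma cmulE {R : realType} {s : nat} (u v : 'cV[R]_s) i :
  cmul u v i 0 = u i 0 * v i 0.
Proof. by rewrite mxE. Qed.

(* What the order conditions still demand once the coefficients have the
   common form. *)
Definition drift_system {R : realType} (M : srk_coeffs R 3)
    (c1 c2 c5 : R) : Prop :=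
  [/\ alpha M 0 0 = 1 - alpha M 1 0 - alpha M 2 0,
      alpha M 1 0 * A0 M 1 0 + alpha M 2 0 * (A0 M 2 0 + A0 M 2 1) = 1 / 2,
      alpha M 1 0 * B0 M 1 0 ^+ 2 + alpha M 2 0 * (B0 M 2 0 + B0 M 2 1) ^+ 2 = 1 / 2 &
      alpha M 1 0 * B0 M 1 0 + alpha M 2 0 * (B0 M 2 0 + B0 M 2 1) = c1 / 2] /\
  [/\ alpha M 2 0 * B0 M 2 1 = 0, c2 * B0 M 1 0 = 0 & c5 * B0 M 1 0 = 0].

(** * Two-point moment problems for the weights [beta1] to [beta4] *)

(** Subtracting [v] times the first moment from the second gives [p * u * (u - v) = m]; subtracting
    [v ^+ 2] times the first from the third gives [m * (u + v) = 0]. Hence [v = - u], and the first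
    moment then yields [p = q]. *)
Lemma symmetric_nodes {R : realType} {p q u v m : R} : m != 0 ->
  p * u + q * v = 0 -> p * u ^+ 2 + q * v ^+ 2 = m -> p * u ^+ 3 + q * v ^+ 3 = 0 ->
  [/\ u != 0, v = - u, p = m / (2 * u ^+ 2) & q = m / (2 * u ^+ 2)].
Proof.
move=> m0 e1 e2 e3.
have e1v : (p * u + q * v) * v = 0 by rewrite e1 mul0r.
have e1vv : (p * u + q * v) * v * v = 0 by rewrite e1v mul0r.
have e2' : p * u * (u - v) = m by lra.
have vN : v = - u.
  have /eqP : m * (u + v) = 0 by rewrite -e2'; lra.
  by rewrite mulf_eq0 (negPf m0) /= => /eqP; lra.
subst v.
have u0 : u != 0 by apply: contra_neq m0 => u0; rewrite -e2' u0; ring.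
have pq : p = q by apply: (mulIf u0); lra.
subst q; have pE : p = m / (2 * u ^+ 2) by rewrite -e2'; field.
by split.
Qed.

(** Meant for [beta2] (conditions 13, 32) and [beta4] (conditions 14, 33) once the nodes are known
    to be opposite: the second moment forces [q = - p], the first fixes [p]. *)
Lemma antisymmetric_weights {R : realType} {p q u : R} : u != 0 ->
  p * u + q * - u = 1 -> p * u ^+ 2 + q * (- u) ^+ 2 = 0 ->
  p = 1 / (2 * u) /\ q = - (1 / (2 * u)).
Proof.
move=> u0 e1 e2.
have qN : q = - p by apply: (mulIf u0); apply: (mulIf u0); lra.
subst q; suff -> : p = 1 / (2 * u) by [].
by rewrite -[X in X / _]e1; field.
Qed.

(** * At most two stages *)

Lemma dot_single {R : realType} {s : nat} {i : 'I_s} (u v : 'cV[R]_s) :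
  (forall j, j != i -> v j 0 = 0) -> dot u v = u i 0 * v i 0.
Proof.
move=> v0; rewrite /dot mxE (bigD1 i) //= big1 ?addr0 ?mxE // => j ji.
by rewrite v0 ?mulr0.
Qed.

(* With at most two stages [B1 *m ones] has at most one nonzero entry, so
   condition 6 makes the left-hand side of condition 15 vanish. *)
Lemma no_order22_le2 {R : realType} {s : nat} (M : srk_coeffs R s) :
  (s <= 2)%N -> explicit_srk M -> ~ order22 M.
Proof.
case: s M => [|n] M sle [_ [_ lB1 _]] oM.
  by have /eqP := cond1 oM; rewrite /dot mxE big_ord0 eq_sym oner_eq0.
(* Among at most two stages a non-last one is the first, whose row of [B1] is zero. *)
have u0 j : j != ord_max -> (B1 M *m ones R n.+1) j 0 = 0.
  move=> jmax; rewrite mxE big1 // => k _; rewrite lB1 ?mul0r //.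
  have : (j < n)%N by rewrite ltn_neqAle -ltnS ltn_ord andbT.
  by move=> /leq_trans /(_ sle); rewrite ltnS leqn0 => /eqP ->.
have := cond15 oM; have := cond6 oM; rewrite !(dot_single _ _ u0).
rewrite (@dot_single _ _ ord_max _ (cpow _ _)) => [e6|j /u0 uj]; last first.
  by rewrite cpowE uj expr0n.
by rewrite cpowE expr2 [X in _ * X]mulrA e6 mul0r mulr0; lra.
Qed.

(** * Three stages: order conditions versus common form and drift system *)

Lemma mulf_mid_eq0 {R : idomainType} {a b c : R} :
  a != 0 -> c != 0 -> a * (b * c) = 0 -> b = 0.
Proof.
by move=> a0 c0 /eqP; rewrite !mulf_eq0 (negPf a0) (negPf c0) orbF => /eqP.
Qed.

Lemma first_weight {R : pzRingType} {a b c d : R} : a + b + c = d -> a = d - b - c.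
Proof. by move=> <-; rewrite addrAC addrK addrK. Qed.

Lemma order22_common_form {R : realType} (M : srk_coeffs R 3) :
  explicit_srk M -> order22 M ->
  exists c1 c2 c3 c4 c5 : R,
    [/\ c1 = -1 \/ c1 = 1, c3 != 0 & c4 != 0] /\
    common_form M c1 c2 c3 c4 c5 /\ drift_system M c1 c2 c5.
Proof.
move=> [[lA0 lA1 lA2] [lB0 lB1 lB2]].
have E := (@dot3E R, @cpowE R 3, @cmulE R 3, @onesE R 3,
  lower_mulmxE lA0, lower_mulmxE lA1, lower_mulmxE lA2,
  lower_mulmxE lB0, lower_mulmxE lB1, lower_mulmxE lB2).
move=> [] h1 h2 h3 h4 h5 h6 h7 h8 h9 h10 h11 h12 h13 h14 h15 h16 h17 h18 h19 h20
  h21 h22 h23 _ _ _ _ _ _ _ _ h32 h33 _ _ h36 h37 _ _ _ _ _ _ _ _ _ _ _ _ _.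
move: h1 h2 h3 h4 h5 h6 h7 h8 h9 h10 h11 h12 h13 h14 h15 h16 h17 h18 h19 h20
  h21 h22 h23 h32 h33 h36 h37.
rewrite !E !(mulr1, mulr0, mul0r, add0r, expr0n) /=.
(* The sign [c1] is the total weight of [beta1], of square 1 by condition 4. *)
set c1 := beta1 M 0 0 + _ + _ => a_sum b4_sum b3_sum c1_sqr b2_sum h6 h7 h8 h9 h10
  h11 h12 h13 h14 h15 h16 h17 h18 h19 h20 h21 h22 h23 h32 h33 h36 h37.
(* Removes the prefactor [c1] from conditions 10, 11, 15 and 16, since [c1] is its own inverse. *)
have half X : c1 * X = 1 / 2 -> X = c1 / 2.
  move=> cX; have -> : X = c1 ^+ 2 * X by rewrite c1_sqr mul1r.
  by rewrite expr2 -mulrA cX mulrA mulr1.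
have c1_cases : c1 = -1 \/ c1 = 1.
  by have /eqP := c1_sqr; rewrite sqrf_eq1 => /orP[] /eqP; [right | left].
have c1h_neq0 : c1 / 2 != 0.
  by case: c1_cases => ->; rewrite mulf_neq0 ?invr_neq0 ?oppr_eq0 ?oner_eq0 ?pnatr_eq0.
have [c3_neq0 u3E b12 b13] := symmetric_nodes c1h_neq0 h6 (half _ h15) h36.
have [c4_neq0 v3E b32 b33] := symmetric_nodes c1h_neq0 h7 (half _ h16) h37.
rewrite u3E in h13 h32; rewrite v3E in h14 h33.
have [b22 b23] := antisymmetric_weights c3_neq0 h13 h32.
have [b42 b43] := antisymmetric_weights c4_neq0 h14 h33.
have weight_neq0 x : x != 0 -> c1 / 2 / (2 * x ^+ 2) != 0.
  by move=> x0; rewrite mulf_neq0 // invr_neq0 // mulf_neq0 ?pnatr_eq0 // expf_neq0.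
have inv2_neq0 (x : R) : x != 0 -> 1 / (2 * x) != 0.
  by move=> x0; rewrite div1r invr_neq0 // mulf_neq0 ?pnatr_eq0.
have b13_neq0 : beta1 M 2 0 != 0 by rewrite b13 weight_neq0.
have b33_neq0 : beta3 M 2 0 != 0 by rewrite b33 weight_neq0.
have b22_neq0 : beta2 M 1 0 != 0 by rewrite b22 inv2_neq0.
have b42_neq0 : beta4 M 1 0 != 0 by rewrite b42 inv2_neq0.
have B1_32 : B1 M 2 1 = 0 by apply: mulf_mid_eq0 h17.
have B2_32 : B2 M 2 1 = 0 by apply: mulf_mid_eq0 h18.
(* As [beta2] and [beta4] are antisymmetric, conditions 22 and 23 equate the last two row sums of
   [A1] and of [A2]. Conditions 11 and 12, whose last two weights are equal, then give their common
   values [c3 ^+ 2] and 0. *)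
have A1e : A1 M 2 0 + A1 M 2 1 = A1 M 1 0.
  by apply/esym/(mulfI b22_neq0)/subr0_eq; rewrite -mulNr -h22 b23 -b22.
have A2e : A2 M 2 0 + A2 M 2 1 = A2 M 1 0.
  by apply/esym/(mulfI b42_neq0)/subr0_eq; rewrite -mulNr -h23 b43 -b42.
have A1_21 : A1 M 1 0 = B1 M 1 0 ^+ 2.
  have := half _ h11; rewrite A1e b12 b13 -mulrDl => e.
  by apply: (mulfI c1h_neq0); rewrite -[in RHS]e; field.
have A2_21 : A2 M 1 0 = 0.
  move: h12; rewrite A2e b32 -b33 -mulrDr -mulr2n => /eqP.
  by rewrite mulf_eq0 (negPf b33_neq0) mulrn_eq0 => /eqP.
have A2_31 : A2 M 2 0 = - A2 M 2 1.
  by apply/eqP; rewrite -addr_eq0 A2e A2_21.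
exists c1, (A1 M 2 1), (B1 M 1 0), (B2 M 1 0), (A2 M 2 0).
split; first by split.
split; last first.
  split; split=> //.
  - exact: first_weight a_sum.
  - exact: half.
  (* Conditions 21, 20 and 19 each reduce to one product, from which a nonzero node or weight is
     cancelled. *)
  - by apply: (mulIf c3_neq0); rewrite mul0r -mulrA.
  - by apply: (mulfI b13_neq0); rewrite mulr0.
  - by apply: (mulfI b33_neq0); rewrite A2_31 mulNr mulrN h19 oppr0 mulr0.
split.
  split; apply/tr_eq_rv3; split=> //.
  - by rewrite (first_weight (erefl c1)) b12 b13; field.
  - by rewrite b12; field.
  - by rewrite b13; field.
  - by rewrite (first_weight b2_sum) b22 b23; ring.
  - by rewrite (first_weight b3_sum) b32 b33; field.
  - by rewrite b32; field.
  - by rewrite b33; field.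
  - by rewrite (first_weight b4_sum) b42 b43; ring.
split; apply/lower_eq_mx3 => //; split=> //.
- by rewrite -A1_21 -A1e addrK.
- by rewrite -u3E B1_32 addr0.
- by rewrite A2_31 opprK.
- by rewrite -v3E B2_32 addr0.
Qed.

(** After substitution each condition is a drift equation, contains a factor that the drift system
    annihilates, or is a rational identity modulo [c1 ^+ 2 = 1]. *)
Lemma common_form_order22 {R : realType} (M : srk_coeffs R 3) (c1 c2 c3 c4 c5 : R) :
  explicit_srk M -> c1 = -1 \/ c1 = 1 -> c3 != 0 -> c4 != 0 ->
  common_form M c1 c2 c3 c4 c5 -> drift_system M c1 c2 c5 -> order22 M.
Proof.
move=> [[lA0 lA1 lA2] [lB0 lB1 lB2]] c1_cases c3_neq0 c4_neq0.
have E := (@dot3E R, @cpowE R 3, @cmulE R 3, @onesE R 3,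
  lower_mulmxE lA0, lower_mulmxE lA1, lower_mulmxE lA2,
  lower_mulmxE lB0, lower_mulmxE lB1, lower_mulmxE lB2).
case=> -[/tr_eq_rv3[b11 b12 b13] /tr_eq_rv3[b21 b22 b23]].
move=> /tr_eq_rv3[b31 b32 b33] /tr_eq_rv3[b41 b42 b43].
case=> /(lower_eq_mx3 _ _ _ lA1)[a1 a2 a3] /(lower_eq_mx3 _ _ _ lB1)[b1 b2 b3].
move=> /(lower_eq_mx3 _ _ _ lA2)[a4 a5 a6] /(lower_eq_mx3 _ _ _ lB2)[b4 b5 b6].
have F := (b11, b12, b13, b21, b22, b23, b31, b32, b33, b41, b42, b43,
  a1, a2, a3, b1, b2, b3, a4, a5, a6, b4, b5, b6).
move=> [[d1 d2 d3 d4] [d5 d6 d7]].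
(* The squares occur in conditions 28 and 29; [a3_0] serves conditions 21 and 40. *)
have c2_sqr : c2 * B0 M 1 0 ^+ 2 = 0 by rewrite expr2 mulrA d6 mul0r.
have c5_sqr : c5 * B0 M 1 0 ^+ 2 = 0 by rewrite expr2 mulrA d7 mul0r.
have a3_0 x : alpha M 2 0 * (B0 M 2 1 * x) = 0 by rewrite mulrA d5 mul0r.
have b1_sum : c1 - c1 / (2 * c3 ^+ 2) + c1 / (4 * c3 ^+ 2) + c1 / (4 * c3 ^+ 2) = c1.
  by field.
have c1_sqr : c1 * c1 = 1 by case: c1_cases => ->; ring.
split; rewrite !E ?F !(mulr1, mulr0, mul0r, add0r, addr0, expr0n) /=;
  rewrite ?(b1_sum, mulNr, d6, d7, c2_sqr, c5_sqr, a3_0, oppr0, mulr0, mul0r) //.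
- by rewrite d1; ring.
- exact: subrr.
- by field.
- exact: subrr.
- by field.
- by field.
- by rewrite d4 mulrA c1_sqr.
- by case: c1_cases => ->; field.
- by field.
- by field.
- by field.
- by case: c1_cases => ->; field.
- by case: c1_cases => ->; field.
- by field.
- by field.
- by field.
- by field.
- by field.
- by field.
- by field.
- by field.
- by rewrite mulrCA a3_0 mulr0.
Qed.

(** * Solutions of the drift system *)

Lemma drift_cases_sound {R : realType} (M : srk_coeffs R 3) (c1 c2 c5 : R) :
  explicit_srk M -> c1 = -1 \/ c1 = 1 ->
  (caseA M c1 c2 c5 \/ caseBai M c1 \/ caseBaii M c1 \/ caseBbi M c1 c2 c5 \/
   caseBbii M c1 c2 c5 \/ caseBbiii M c1 c2 c5) ->
  drift_system M c1 c2 c5.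
Proof.
move=> [[lA0 _ _] [lB0 _ _]] c1_cases; rewrite /drift_system.
have c1_sqr : c1 ^+ 2 = 1 by case: c1_cases => ->; ring.
have c1h : c1 / 2 * (c1 / 2) = 1 / 4 by case: c1_cases => ->; field.
case=> [|[|[|[|[|]]]]].
- case=> -[-> ->] [/tr_eq_rv3[-> -> ->]].
  move=> /(lower_eq_mx3 _ _ _ lA0)[-> -> ->] /(lower_eq_mx3 _ _ _ lB0)[-> -> ->].
  by rewrite !add0r c1_sqr; split; split; field.
- case=> c6 [c7] [/tr_eq_rv3[-> -> ->]].
  move=> /(lower_eq_mx3 _ _ _ lA0)[-> -> ->] /(lower_eq_mx3 _ _ _ lB0)[-> -> ->].
  by rewrite !addr0 c1_sqr; split; split; field.
- case=> c6 [c7 [c8]] [c6_neq0] [/tr_eq_rv3[-> -> ->]].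
  move=> /(lower_eq_mx3 _ _ _ lA0)[-> -> ->] /(lower_eq_mx3 _ _ _ lB0)[-> -> ->].
  by rewrite !addr0 c1_sqr; split; split; field.
- case=> -[-> ->] [c6 [c7 [c8 [c9 [sg]]]]] [[c6_neq0 c7_neq0 c67]].
  case=> [[kappa_ge0 sg_cases _]] [/tr_eq_rv3[-> -> ->]].
  move=> /(lower_eq_mx3 _ _ _ lA0)[-> -> ->] /(lower_eq_mx3 _ _ _ lB0)[-> -> ->].
  have c67_neq0 : c6 + c7 != 0 by rewrite addr_eq0.
  set t := sg * _.
  have t_sqr : t ^+ 2 = c6 * c7 * (2 * c6 + 2 * c7 - 1).
    by rewrite exprMn sqr_sqrtr //; case: sg_cases => ->; ring.
  rewrite !addr0 subrK.
  have c1_sqrM x : (c1 / 2 * x) ^+ 2 = x ^+ 2 / 4.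
    by rewrite exprMn expr2 c1h; ring.
  split; split; rewrite ?c1_sqrM ?mulr0 ?mul0r //.
  + by field.
  (* In the weighted sum of squares the terms linear in [t] cancel; inserting kappa for [t ^+ 2]
     turns the numerator into [2 * c6 * c7 * (c6 + c7)]. *)
  + transitivity ((c6 * c7 + t ^+ 2) / (4 * c6 * c7 * (c6 + c7))).
      by field; rewrite c67_neq0 c7_neq0.
    by rewrite t_sqr; field; rewrite ?c67_neq0 ?c7_neq0.
  + by field; rewrite ?c67_neq0 ?c7_neq0.
- case=> -[-> ->] [c6 [c7 [c8]]] [_] [/tr_eq_rv3[-> -> ->]].
  move=> /(lower_eq_mx3 _ _ _ lA0)[-> -> ->] /(lower_eq_mx3 _ _ _ lB0)[-> -> ->].
  by rewrite !addr0 c1_sqr; split; split; field.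
- case=> -[-> ->] [c6 [c7 [c8]]] [[_ c6_neq0]] [/tr_eq_rv3[-> -> ->]].
  move=> /(lower_eq_mx3 _ _ _ lA0)[-> -> ->] /(lower_eq_mx3 _ _ _ lB0)[-> -> ->].
  have c1_sqrM x : (c1 / 2 * x) ^+ 2 = x ^+ 2 / 4.
    by rewrite exprMn expr2 c1h; ring.
  by rewrite !addr0 !c1_sqrM; split; split; field.
Qed.

Lemma drift_cases_complete {R : realType} (M : srk_coeffs R 3) (c1 c2 c5 : R) :
  explicit_srk M -> alpha3_convention M -> c1 = -1 \/ c1 = 1 ->
  drift_system M c1 c2 c5 ->
  caseA M c1 c2 c5 \/ caseBai M c1 \/ caseBaii M c1 \/ caseBbi M c1 c2 c5 \/
  caseBbii M c1 c2 c5 \/ caseBbiii M c1 c2 c5.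
Proof.
move=> [[lA0 _ _] [lB0 _ _]] conv c1_cases [[a1E h8 h9 h10] [h21 h20 h19]].
have c1_neq0 : c1 != 0 by case: c1_cases => ->; lra.
have c1_sqr : c1 ^+ 2 = 1 by case: c1_cases => ->; ring.
(* Either the convention for vanishing [alpha3] applies, or [alpha3] cancels in condition 21. *)
have B0_32 : B0 M 2 1 = 0.
  have [/conv[_ _ _ //]|a3_neq0] := eqVneq (alpha M 2 0) 0.
  by apply: (mulfI a3_neq0); rewrite h21 mulr0.
rewrite B0_32 addr0 in h9 h10.
(* When a single node contributes, comparing its first two moments determines both node and
   weight. *)
have single w D : w * D ^+ 2 = 1 / 2 -> w * D = c1 / 2 -> w = 1 / 2 /\ D = c1.
  move=> wDD wD; have DE : D = c1.
    apply: (mulfI c1_neq0); rewrite -expr2 c1_sqr.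
    have : w * D * D = 1 / 2 by rewrite -wDD; ring.
    by rewrite wD; lra.
  by split=> //; apply: (mulIf c1_neq0); rewrite -{1}DE wD; field.
have [D2_0|D2_neq0] := eqVneq (B0 M 1 0) 0.
  rewrite D2_0 in h9 h10.
  have [a3E D3E] : alpha M 2 0 = 1 / 2 /\ B0 M 2 0 = c1.
    by apply: single; [rewrite -h9 | rewrite -h10]; ring.
  rewrite a3E in h8; right.
  (* Condition 8 determines [alpha2] exactly when this entry is nonzero, which separates (B.a.i)
     from (B.a.ii). *)
  have [x0|x_neq0] := eqVneq (A0 M 1 0) 0.
    left; exists (alpha M 1 0), (A0 M 2 0); split.
    - by apply/tr_eq_rv3; split=> //; lra.
    - by apply/(lower_eq_mx3 _ _ _ lA0); split=> //; rewrite x0 in h8; lra.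
    - by apply/(lower_eq_mx3 _ _ _ lB0).
  right; left; exists (A0 M 1 0), (A0 M 2 0), (A0 M 2 1); split=> //.
  have a2E : alpha M 1 0 = (1 - A0 M 2 0 - A0 M 2 1) / (2 * A0 M 1 0).
    by apply: (mulIf x_neq0); transitivity ((1 - A0 M 2 0 - A0 M 2 1) / 2);
      [lra | field].
  split.
  - by apply/tr_eq_rv3; rewrite -a2E a3E; split=> //; lra.
  - by apply/(lower_eq_mx3 _ _ _ lA0).
  - by apply/(lower_eq_mx3 _ _ _ lB0).
have c2_0 : c2 = 0 by apply: (mulIf D2_neq0); rewrite h20 mul0r.
have c5_0 : c5 = 0 by apply: (mulIf D2_neq0); rewrite h19 mul0r.
have [a3_0|a3_neq0] := eqVneq (alpha M 2 0) 0.
  have [A0_31 A0_32 B0_31 _] := conv a3_0.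
  rewrite a3_0 !mul0r !addr0 in h8 h9 h10.
  have [a2E D2E] := single _ _ h9 h10.
  left; split=> //; split.
  - by apply/tr_eq_rv3; split=> //; lra.
  - by apply/(lower_eq_mx3 _ _ _ lA0); split=> //; rewrite a2E in h8; lra.
  - by apply/(lower_eq_mx3 _ _ _ lB0).
have [a2_0|a2_neq0] := eqVneq (alpha M 1 0) 0.
  rewrite a2_0 !mul0r !add0r in h8 h9 h10.
  have [a3E D3E] := single _ _ h9 h10.
  do 4!right; left; split=> //; exists (A0 M 1 0), (A0 M 2 1), (B0 M 1 0).
  split=> //; split.
  - by apply/tr_eq_rv3; split=> //; lra.
  - by apply/(lower_eq_mx3 _ _ _ lA0); split=> //; rewrite a3E in h8; lra.
  - by apply/(lower_eq_mx3 _ _ _ lB0).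
have A0_31 : A0 M 2 0 =
    (1 - 2 * alpha M 1 0 * A0 M 1 0) / (2 * alpha M 2 0) - A0 M 2 1.
  apply: (addIr (A0 M 2 1)); rewrite subrK; apply: (mulfI a3_neq0).
  by transitivity ((1 - 2 * alpha M 1 0 * A0 M 1 0) / 2); [lra | field].
have [a23|a23] := eqVneq (alpha M 1 0) (- alpha M 2 0).
  have a3E : alpha M 2 0 = - alpha M 1 0 by lra.
  (* With opposite weights, condition 10 fixes the difference of the nodes; condition 9 is a
     difference of squares and then fixes their sum. *)
  have diffE : B0 M 1 0 - B0 M 2 0 = c1 / (2 * alpha M 1 0).
    apply: (mulfI a2_neq0); transitivity (c1 / 2); last by field.
    by rewrite -h10 a3E; ring.
  have sumE : B0 M 1 0 + B0 M 2 0 = c1.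
    apply: (mulfI c1_neq0); rewrite -expr2 c1_sqr.
    have : alpha M 1 0 * B0 M 1 0 + alpha M 2 0 * B0 M 2 0 = c1 / 2 := h10.
    rewrite a3E in h9 * => e.
    have : (alpha M 1 0 * B0 M 1 0 - alpha M 1 0 * B0 M 2 0)
           * (B0 M 1 0 + B0 M 2 0) = 1 / 2 by rewrite -h9; ring.
    by rewrite -mulNr e; lra.
  have D2E : B0 M 1 0 = c1 / 2 * (1 + 1 / (2 * alpha M 1 0)).
    transitivity ((c1 + c1 / (2 * alpha M 1 0)) / 2); last by field.
    by rewrite -diffE -sumE; field.
  do 5!right; split=> //; exists (alpha M 1 0), (A0 M 1 0), (A0 M 2 1).
  split.
    split=> //; apply: contra_neq D2_neq0 => a2E; rewrite D2E a2E.
    by field; lra.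
  rewrite a3E mulrN in A0_31; split.
  - by apply/tr_eq_rv3; split=> //; lra.
  - by apply/(lower_eq_mx3 _ _ _ lA0).
  - apply/(lower_eq_mx3 _ _ _ lB0); split=> //.
    transitivity ((c1 - c1 / (2 * alpha M 1 0)) / 2); last by field.
    by rewrite -diffE -sumE; field.
have a23_neq0 : alpha M 1 0 + alpha M 2 0 != 0 by rewrite addr_eq0.
do 3!right; left; split=> //.
(* Found by solving the formula for [B0_21] in (B.b.i) for the signed root [sg * Num.sqrt kappa]. *)
pose t := alpha M 1 0
  - 2 * alpha M 1 0 * (alpha M 1 0 + alpha M 2 0) * (c1 * B0 M 1 0).
pose kappa :=
  alpha M 1 0 * alpha M 2 0 * (2 * alpha M 1 0 + 2 * alpha M 2 0 - 1).
have D3E : B0 M 2 0 = (c1 / 2 - alpha M 1 0 * B0 M 1 0) / alpha M 2 0.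
  by apply: (mulfI a3_neq0); rewrite [RHS]mulrC divfK //; lra.
(* Eliminating [B0_31] between conditions 9 and 10 leaves a quadratic equation for [B0_21]; [t_sqr]
   completes its square. *)
have quad : alpha M 1 0 * (alpha M 1 0 + alpha M 2 0) * B0 M 1 0 ^+ 2
    - c1 * alpha M 1 0 * B0 M 1 0 = alpha M 2 0 / 2 - 1 / 4.
  have : alpha M 2 0 * (1 / 2) = alpha M 1 0 * alpha M 2 0 * B0 M 1 0 ^+ 2
      + (c1 / 2 - alpha M 1 0 * B0 M 1 0) ^+ 2.
    by rewrite -h9 D3E; field.
  have : (c1 / 2 - alpha M 1 0 * B0 M 1 0) ^+ 2
    = 1 / 4 - c1 * alpha M 1 0 * B0 M 1 0 + alpha M 1 0 ^+ 2 * B0 M 1 0 ^+ 2.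
    have -> : 1 / 4 = c1 ^+ 2 / 4 :> R by rewrite c1_sqr.
    by field.
  lra.
have t_sqr : t ^+ 2 = kappa.
  have -> : t ^+ 2 = alpha M 1 0 ^+ 2 + 4 * alpha M 1 0 * (alpha M 1 0 + alpha M 2 0)
      * (alpha M 1 0 * (alpha M 1 0 + alpha M 2 0) * (c1 ^+ 2 * B0 M 1 0 ^+ 2)
         - c1 * alpha M 1 0 * B0 M 1 0) by rewrite /t; ring.
  by rewrite c1_sqr mul1r quad /kappa; field.
(* The sign of [t] selects the root, with [sg = 1] when [t] is zero. *)
have [sg sg_cases tE] : exists2 sg : R, sg = 1 \/ sg = -1 & t = sg * Num.sqrt kappa.
  rewrite -t_sqr sqrtr_sqr; have [t_ge0|t_lt0] := lerP 0 t.
    by exists 1; [left | rewrite ger0_norm ?mul1r].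
  by exists (-1); [right | rewrite ltr0_norm // mulrNN mul1r].
have D2E : B0 M 1 0 = c1 / 2 *
    ((alpha M 1 0 - t) / (alpha M 1 0 * (alpha M 1 0 + alpha M 2 0))).
  transitivity (c1 ^+ 2 * B0 M 1 0); first by rewrite c1_sqr mul1r.
  by rewrite /t; field; rewrite ?a2_neq0 ?a23_neq0.
exists (alpha M 1 0), (alpha M 2 0), (A0 M 1 0), (A0 M 2 1), sg.
rewrite /= -/kappa -tE; split; first by split.
split.
  split=> //; first by rewrite -t_sqr sqr_ge0.
  by apply: contra_neq D2_neq0 => a2t; rewrite D2E -a2t subrr mul0r mulr0.
split.
- exact/tr_eq_rv3.
- exact/(lower_eq_mx3 _ _ _ lA0).
- apply/(lower_eq_mx3 _ _ _ lB0); split=> //.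
  by rewrite D3E D2E; field; rewrite ?a2_neq0 ?a3_neq0 ?a23_neq0.
Qed.

Theorem mainTheorem3 (R : realType) :
  (forall s : nat, (s <= 2)%N ->
     ~ exists M : srk_coeffs R s, explicit_srk M /\ order22 M) /\
  (forall M : srk_coeffs R 3, explicit_srk M -> alpha3_convention M ->
     (order22 M <->
      exists c1 c2 c3 c4 c5 : R,
        [/\ c1 = -1 \/ c1 = 1, c3 != 0 & c4 != 0] /\
        common_form M c1 c2 c3 c4 c5 /\
        (caseA M c1 c2 c5 \/
         caseBai M c1 \/
         caseBaii M c1 \/
         caseBbi M c1 c2 c5 \/
         caseBbii M c1 c2 c5 \/
         caseBbiii M c1 c2 c5))).
Proof.
split=> [s sle [M [exM oM]]|M exM conv]; first exact: no_order22_le2 oM.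
split=> [oM|[c1 [c2 [c3 [c4 [c5 [[c1P c3P c4P] [formM casesM]]]]]]]].
  have [c1 [c2 [c3 [c4 [c5 [[c1P c3P c4P] [formM driftM]]]]]]] :=
    order22_common_form _ exM oM.
  exists c1, c2, c3, c4, c5; split; first by split.
  by split; last exact: drift_cases_complete.
apply: common_form_order22 formM _ => //.
exact: drift_cases_sound.
Qed.
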